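(* Let a vector $a_0\in\mathbb R^k_+$ belong to the interior of the cone generated by vectors $a_j\in\mathbb R^k_+$, $j=1,2,\dots$, where the dimension of the cone is $1\le r\le k$, and let $r$ linearly independent vectors $a_1,\dots,a_r$ be such that $a_0$ belongs to the interior of the cone generated by these vectors. Let $\{f_1,\dots,f_k\}$ be a set of linearly independent vectors satisfying $$\langle f_i,a_j\rangle=\delta_{ij},\ i,j=1,\dots,r,\qquad \langle f_i,a_j\rangle=0,\ j=1,\dots,r,\ i=r+1,\dots,k.$$ Consider the set of equations $$\sum_{j=1}^\infty a_j\xi_j=a_0 \qquad ( * )$$ in the unknown $\{\xi_j\}_{j=1}^\infty$. Then there exist infinitely many linearly independent nonnegative solutions $z_i$, $i=r,r+1,\dots$, of $( * )$, where $$z_r=\{\langle a_0,f_1\rangle,\dots,\langle a_0,f_r\rangle,0,0,\dots\},$$ $$z_i=\{\langle a_0,f_1\rangle-\langle a_i,f_1\rangle y_i^*,\dots,\langle a_0,f_r\rangle-\langle a_i,f_r\rangle y_i^*,0,\dots,0,y_i^*,0,\dots\},\qquad i\ge r+1,$$ with $y_i^*$ in the $i$-th place and $$y_i^*=\begin{cases}\min\limits_{l\in K_i}\dfrac{\langle a_0,f_l\rangle}{\langle a_i,f_l\rangle}, & K_i=\{l:\ 1\le l\le r,\ \langle a_i,f_l\rangle>0\}\neq\emptyset,\\[2mm] 1, & \langle a_i,f_l\rangle\le0\ \text{ for all } l=1,\dots,r.\end{cases}$$ The set of strictly positive solutions of $( * )$ is given by the formula $$z=\sum_{i=r}^\infty\gamma_iz_i,$$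 where the vector $\gamma=\{\gamma_r,\dots,\gamma_i,\dots\}$ satisfies the conditions $$\sum_{i=r}^\infty\gamma_i=1,\qquad \gamma_i>0,\ i\ge r+1,\qquad \sum_{i=r+1}^\infty a_i\gamma_iy_i^*<\infty,$$ $$\Big\langle a_0-\sum_{i=r+1}^\infty a_i\gamma_iy_i^*,f_l\Big\rangle>0,\qquad l=1,\dots,r.$$
   Context: $\langle\cdot,\cdot\rangle$ is the scalar product in $\mathbb R^k$ and $\delta_{ij}$ is the Kronecker symbol. A vector $a_0\in\mathbb R^k_+$ belongs to the interior of the nonnegative cone generated by vectors $a_j\in\mathbb R^k_+$, $j=1,2,\dots$ (a finite or countable family) if there exist positive numbers $\alpha_j>0$ (one for every $j$ in the family) such that $\sum_j\alpha_ja_j=a_0$. The inequality $\sum a_i\gamma_iy_i^*<\infty$ means that the vector series converges. A solution is nonnegative (strictly positive) if all its coordinates are nonnegative (strictly positive).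
   Formalization: That every strictly positive solution is given by the formula is stated only when at most finitely many of the vectors a_j are zero; if infinitely many vanish it fails, e.g. k=r=1, a_0=a_1=1, a_j=0 for j≥2, with solution (1,1,1,…). *)

(* Defs.v *)
From HB Require Import structures.
From mathcomp Require Import all_boot all_order all_algebra.
From mathcomp Require Import all_classical all_reals all_analysis.

Set Implicit Arguments.
Unset Strict Implicit.
Unset Printing Implicit Defensive.

Import Order.TTheory GRing.Theory Num.Theory.
Import numFieldNormedType.Exports.

Local Open Scope classical_set_scope.
Local Open Scope ring_scope.

(* Indices start at 0: a vector or coordinate written with subscript j >= 1
   on paper has index j - 1 here.  The target a_0 is the separate vector a0. *)

Section Cones.
Context {R : realType} {k : nat}.
Implicit Types (v : 'rV[R]_k) (a : nat -> 'rV[R]_k) (J : pred nat).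

Definition dotv (u v : 'rV[R]_k) : R := \sum_(i < k) u 0 i * v 0 i.

Definition nonneg_vec v : Prop := forall i, 0 <= v 0 i.

(* The families below are (a j) for j in J, finite or countable according to J. *)
Definition cone a J : set 'rV[R]_k :=
  [set v | exists2 alpha : nat -> R, (forall j, J j -> 0 <= alpha j) &
     (\sum_(0 <= j < n | J j) alpha j *: a j) @[n --> \oo] --> v].

(* Not the topological interior, which is empty when the cone is not
   full-dimensional: v is a combination with all coefficients positive. *)
Definition cone_interior a J : set 'rV[R]_k :=
  [set v | exists2 alpha : nat -> R, (forall j, J j -> 0 < alpha j) &
     (\sum_(0 <= j < n | J j) alpha j *: a j) @[n --> \oo] --> v].

Definition is_linear_hull (C : set 'rV[R]_k) (V : {vspace 'rV[R]_k}) : Prop :=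
  (forall v, C v -> v \in V) /\
  (forall W : {vspace 'rV[R]_k}, (forall v, C v -> v \in W) -> (V <= W)%VS).

Definition has_dim (C : set 'rV[R]_k) (r : nat) : Prop :=
  exists2 V, is_linear_hull C V & \dim V = r.

End Cones.

Definition lin_indep {R : realType} (u : nat -> nat -> R) : Prop :=
  forall (N : nat) (c : nat -> R),
    (forall j, \sum_(m < N) c m * u m j = 0) -> forall m, (m < N)%N -> c m = 0.

Section System.
Context {R : realType} {k : nat}.
Variables (r : nat) (a0 : 'rV[R]_k) (a : nat -> 'rV[R]_k).
Variable f : k.-tuple 'rV[R]_k.

Definition solution (xi : nat -> R) : Prop :=
  series (fun j => xi j *: a j) @ \oo --> a0.

Definition nonneg_solution (xi : nat -> R) : Prop :=
  solution xi /\ forall j, 0 <= xi j.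

Definition strictly_positive_solutions : set (nat -> R) :=
  [set xi | solution xi /\ forall j, 0 < xi j].

Definition Kset (i : nat) : {set 'I_r} := [set l : 'I_r | 0 < dotv (a i) f`_l].

Definition ystar (i : nat) : R :=
  let ratio l := dotv a0 f`_l / dotv (a i) f`_l in
  if [pick l in Kset i] is Some l0
  then \big[Num.min/ratio l0]_(l in Kset i) ratio l
  else 1.

(* zsol m is z_(r+m): zsol 0 is the solution supported by the first r
   coordinates, and zsol m.+1 is the one whose free coordinate is at the
   (0-based) place r + m. *)
Definition zsol (m j : nat) : R :=
  match m with
  | 0 => if (j < r)%N then dotv a0 f`_j else 0
  | m'.+1 =>
      let i := (r + m')%N in
      if (j < r)%N then dotv a0 f`_j - dotv (a i) f`_j * ystar i
      else if j == i then ystar i else 0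
  end.

Definition tail_term (gamma : nat -> R) (m : nat) : 'rV[R]_k :=
  (gamma m.+1 * ystar (r + m)) *: a (r + m)%N.

(* gamma m is the weight of zsol m, i.e. gamma_(r+m); no sign is imposed on gamma 0. *)
Definition admissible : set (nat -> R) :=
  [set gamma | [/\ series gamma @ \oo --> (1 : R),
     forall m, 0 < gamma m.+1,
     cvgn (series (tail_term gamma)) &
     forall l, (l < r)%N ->
       0 < dotv (a0 - limn (series (tail_term gamma))) f`_l]].

(* The infinite sum of sequences is taken coordinatewise. *)
Definition combination (gamma : nat -> R) : nat -> R :=
  fun j => limn (series (fun m => gamma m * zsol m j)).

End System.

(* Main.v *)
Require Import Defs.
From HB Require Import structures.
From mathcomp Require Import all_boot all_order all_algebra.
From mathcomp Require Import all_classical all_reals all_analysis.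

Set Implicit Arguments.
Unset Strict Implicit.
Unset Printing Implicit Defensive.

Import Order.TTheory GRing.Theory Num.Theory.
Import numFieldNormedType.Exports.

Local Open Scope classical_set_scope.
Local Open Scope ring_scope.

(** The vectors [f_1, ..., f_r] read off coordinates in the basis
    [a_1, ..., a_r] of the span of the cone: since that span has dimension [r],
    every [a_i] equals the sum of [<a_i, f_l> a_l] ([cone_expansion]), and [a_0]
    has positive coordinates ([interior_coord_gt0]).  Passing to the limit, the
    sum of any convergent series of multiples of the [a_i] has the same
    expansion.  Hence the first [r] unknowns are determined by the others: [xi]
    is a solution exactly when the tail series of the [xi_i a_i], [i > r],
    converges, to [T] say, and [xi_l = <a_0 - T, f_l>] for [l <= r]
    ([solution_of_tail], [tail_of_solution]).

    The solution [z_i] has the tail [y_i* a_i], and [y_i*] is the largest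
    multiple that keeps the first [r] coordinates nonnegative (or 1 when there is
    no such bound).  A combination with weights [gamma] of total mass 1 has the
    tail [gamma_i y_i*] and the first coordinates [<a_0 - T, f_l>]
    ([cvg_combination]); so admissible weights give strictly positive solutions.

    Conversely a strictly positive solution forces [gamma_i = xi_i / y_i*] for
    [i > r], with [gamma_r] taking up the rest of the mass, and the question is
    whether these weights are summable.  If [a_i <> 0] then some [<a_i, f_l>] is
    positive, because otherwise [a_i] would be both nonnegative and a nonpositive
    combination of the nonnegative [a_l].  In that case
    [1 / y_i* = <a_i, f_l> / <a_0, f_l>] for some [l], which is at most
    [<a_i, w>] for one fixed vector [w] ([gauge], [inv_ystar_le]); this uses
    [a_i >= 0].  The series of the [xi_i <a_i, w>] converges, to [<a_0, w>], so
    the weights are summable as soon as only finitely many [a_i] vanish. *)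

(** * Series in normed modules *)

Section SeriesFacts.
Context {R : realType} {V : normedModType R}.
Implicit Types (u : nat -> V).

Lemma cvg_series_finite_support u N :
  (forall j, (N <= j)%N -> u j = 0) -> series u @ \oo --> \sum_(0 <= j < N) u j.
Proof.
move=> u0; apply: cvg_near_cst; exists N => // n /= Nn.
rewrite /series /= (big_cat_nat (leq0n N) Nn) /= [X in _ + X]big_nat.
by rewrite [X in _ + X]big1 ?addr0 // => j /andP[Nj _]; exact: u0.
Qed.

Lemma series_addl u r n :
  series u (n + r)%N =
  \sum_(0 <= j < r) u j + series (fun m => u (r + m)%N) n.
Proof.
rewrite /series /= (big_cat_nat (leq0n r) (leq_addl n r)) /=; congr (_ + _).
rewrite -{1}[r in LHS]add0n big_addn addnK.
by apply: eq_bigr => m _; rewrite addnC.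
Qed.

Lemma cvg_series_tail u r l :
  series u @ \oo --> l ->
  series (fun m => u (r + m)%N) @ \oo --> l - \sum_(0 <= j < r) u j.
Proof.
rewrite -(cvg_shiftn r) /= => ul.
rewrite (_ : series _ = (fun n => series u (n + r)%N - \sum_(0 <= j < r) u j)).
  by apply: cvgB => //; exact: cvg_cst.
by apply/funext => n; rewrite series_addl addrC addKr.
Qed.

Lemma cvg_series_head u r l :
  series (fun m => u (r + m)%N) @ \oo --> l ->
  series u @ \oo --> \sum_(0 <= j < r) u j + l.
Proof.
move=> ul; rewrite -(cvg_shiftn r) /=.
rewrite (_ : (fun n => _) =
    (fun n => \sum_(0 <= j < r) u j + series (fun m => u (r + m)%N) n)).
  by apply: cvgD => //; exact: cvg_cst.
by apply/funext => n; rewrite series_addl.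
Qed.

Lemma cvg_bigsum (I : Type) (s : seq I) (P : pred I) (g : I -> nat -> V)
    (l : I -> V) :
  (forall i, P i -> g i @ \oo --> l i) ->
  (fun n => \sum_(i <- s | P i) g i n) @ \oo --> \sum_(i <- s | P i) l i.
Proof. by move=> gl; apply: cvg_big => //; exact: add_continuous. Qed.

Lemma limnE u l : u @ \oo --> l -> limn u = l.
Proof. by apply: cvg_lim; exact: norm_hausdorff. Qed.

End SeriesFacts.

(** * The scalar product *)

Section ScalarProduct.
Context {R : realType} {k : nat}.
Implicit Types (u v w : 'rV[R]_k).

Lemma dotvC u v : dotv u v = dotv v u.
Proof. by apply: eq_bigr => i _; rewrite mulrC. Qed.

Lemma dotvZl c u w : dotv (c *: u) w = c * dotv u w.
Proof. by rewrite /dotv mulr_sumr; apply: eq_bigr => i _; rewrite mxE mulrA. Qed.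

Lemma dotvBl u v w : dotv (u - v) w = dotv u w - dotv v w.
Proof.
by rewrite /dotv -sumrB; apply: eq_bigr => i _; rewrite !mxE mulrBl.
Qed.

Lemma dotv_suml (I : Type) (s : seq I) (P : pred I) (u : I -> 'rV[R]_k) w :
  dotv (\sum_(i <- s | P i) u i) w = \sum_(i <- s | P i) dotv (u i) w.
Proof.
rewrite /dotv exchange_big /=; apply: eq_bigr => j _.
by rewrite summxE mulr_suml.
Qed.

Lemma cvg_dotv (u : nat -> 'rV[R]_k) v w :
  u @ \oo --> v -> (fun n => dotv (u n) w) @ \oo --> dotv v w.
Proof.
move=> uv; apply: cvg_bigsum => i _.
apply: cvgMr_tmp.
apply: (@cvg_comp _ _ _ u (fun M => M 0 i) _ (nbhs v)) => //.
exact: coord_continuous.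
Qed.

Lemma cvg_series_dotv (u : nat -> 'rV[R]_k) v w :
  series u @ \oo --> v -> series (fun j => dotv (u j) w) @ \oo --> dotv v w.
Proof.
move=> /(@cvg_dotv _ _ w); rewrite (_ : series _ = (fun n => dotv (series u n) w)) //.
by apply/funext => n; rewrite /series /= dotv_suml.
Qed.

End ScalarProduct.

(** * Coordinates in the dual basis *)

Section Expansion.
Context {R : realType} {k : nat} (r : nat).
Context (a : nat -> 'rV[R]_k) (f : k.-tuple 'rV[R]_k).
Hypothesis dual : forall l j, (l < r)%N -> (j < r)%N ->
  dotv (a j) f`_l = (l == j)%:R.

Definition expansion (v : 'rV[R]_k) : 'rV[R]_k :=
  \sum_(0 <= l < r) dotv v f`_l *: a l.

Lemma dual_coord (c : nat -> R) l : (l < r)%N ->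
  dotv (\sum_(0 <= j < r) c j *: a j) f`_l = c l.
Proof.
move=> lr; rewrite dotv_suml (big_cat_nat (leq0n l) (ltnW lr)) /=.
rewrite big_nat big1 ?add0r => [|j /andP[_ jl]]; last first.
  by rewrite dotvZl dual ?(ltn_trans jl) // gtn_eqF // mulr0.
rewrite big_ltn // dotvZl dual // eqxx mulr1 big_nat big1 ?addr0 //.
by move=> j /andP[lj jr]; rewrite dotvZl dual // ltn_eqF // mulr0.
Qed.

Lemma expansion_sum (c : nat -> R) :
  expansion (\sum_(0 <= j < r) c j *: a j) = \sum_(0 <= j < r) c j *: a j.
Proof. by apply: eq_big_nat => l /andP[_ lr]; rewrite dual_coord. Qed.

Lemma expansionB u v : expansion (u - v) = expansion u - expansion v.
Proof.
by rewrite -sumrB; apply: eq_bigr => l _; rewrite dotvBl scalerBl.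
Qed.

(** The expansion is a continuous linear map, so its fixed points form a closed
    subspace. *)
Lemma expansion_series_limit (c : nat -> R) (b : nat -> 'rV[R]_k) T :
  (forall j, expansion (b j) = b j) ->
  series (fun j => c j *: b j) @ \oo --> T -> expansion T = T.
Proof.
move=> bE bT.
have eT : (fun n => expansion (series (fun j => c j *: b j) n)) @ \oo
    --> expansion T.
  by apply: cvg_bigsum => l _; apply: cvgZr_tmp; exact: cvg_dotv.
apply: (cvg_unique (@norm_hausdorff _ _) eT).
rewrite (_ : (fun n => _) = series (fun j => c j *: b j)) //.
apply/funext => n; rewrite /expansion /series /=.
under [LHS]eq_bigr do rewrite dotv_suml scaler_suml.
rewrite exchange_big /=; apply: eq_bigr => j _.
rewrite -{2}bE /expansion scaler_sumr; apply: eq_bigr => l _.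
by rewrite dotvZl scalerA.
Qed.

End Expansion.

(** Every [a i] lies in the cone, hence in its linear hull [V].  The free family
    of the first [r] vectors lies in [V] too and [\dim V = r], so it spans [V];
    duality then identifies the coefficients of [a i]. *)
Lemma cone_expansion (R : realType) (k r : nat) (a : nat -> 'rV[R]_k)
    (f : k.-tuple 'rV[R]_k) :
  (forall l j, (l < r)%N -> (j < r)%N -> dotv (a j) f`_l = (l == j)%:R) ->
  has_dim (cone a xpredT) r -> free [seq a j | j <- iota 0 r] ->
  forall i, expansion r a f (a i) = a i.
Proof.
move=> dual [V [hullV _] dimV] afree.
have aV i : a i \in V.
  apply: hullV; exists (fun j => (j == i)%:R); first by move=> j _; rewrite ler0n.
  have -> : a i = \sum_(0 <= j < i.+1) (j == i)%:R *: a j.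
    rewrite big_nat_recr //= eqxx scale1r big_nat big1 ?add0r // => j /andP[_ ji].
    by rewrite ltn_eqF // scale0r.
  apply: cvg_series_finite_support => j ij.
  by rewrite gtn_eqF // scale0r.
have spanV : <<[seq a j | j <- iota 0 r]>>%VS = V.
  apply/eqP; rewrite eqEdim; apply/andP; split.
    by apply/span_subvP => _ /mapP[j _ ->].
  by rewrite dimV (eqP afree) size_map size_iota.
move=> i; have := aV i; rewrite -spanV.
move=> /(coord_span (X := in_tuple _)) aiE.
(* The default value 0 is never read: only the indices below [r] occur. *)
set c := fun j => if insub j is Some l then
  coord (in_tuple [seq a j | j <- iota 0 r]) l (a i) else 0.
suff -> : a i = \sum_(0 <= j < r) c j *: a j by exact: expansion_sum.
rewrite {1}aiE; have sz : size [seq a j | j <- iota 0 r] = r.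
  by rewrite size_map size_iota.
rewrite -[in RHS]sz big_mkord; apply: eq_bigr => l _.
rewrite /c valK /= (nth_map 0%N) ?size_iota; last by rewrite -[X in (_ < X)%N]sz.
by rewrite nth_iota // -[X in (_ < X)%N]sz.
Qed.

Lemma interior_coord_gt0 (R : realType) (k r : nat) (a0 : 'rV[R]_k)
    (a : nat -> 'rV[R]_k) (f : k.-tuple 'rV[R]_k) :
  (forall l j, (l < r)%N -> (j < r)%N -> dotv (a j) f`_l = (l == j)%:R) ->
  cone_interior a (fun j => (j < r)%N) a0 ->
  expansion r a f a0 = a0 /\ forall l, (l < r)%N -> 0 < dotv a0 f`_l.
Proof.
move=> dual [alpha alpha0 alphaE].
suff -> : a0 = \sum_(0 <= j < r) alpha j *: a j.
  by split=> [|l lr]; rewrite ?expansion_sum // dual_coord // alpha0.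
apply: (cvg_unique (@norm_hausdorff _ _) alphaE).
rewrite (_ : (fun n => _) =
    series (fun j => if (j < r)%N then alpha j *: a j else 0)); last first.
  by apply/funext => n; rewrite /series /= big_mkcond.
rewrite (_ : \sum_(0 <= j < r) alpha j *: a j =
    \sum_(0 <= j < r) (if (j < r)%N then alpha j *: a j else 0)); last first.
  by apply: eq_big_nat => j /andP[_ ->].
by apply: cvg_series_finite_support => j; rewrite leqNgt => /negbTE->.
Qed.

(** * Solutions of the system *)

Section Solutions.
Context {R : realType} {k r : nat} (a0 : 'rV[R]_k) (a : nat -> 'rV[R]_k).
Context (f : k.-tuple 'rV[R]_k).
Hypothesis dual : forall l j, (l < r)%N -> (j < r)%N ->
  dotv (a j) f`_l = (l == j)%:R.
Hypothesis a_exp : forall i, expansion r a f (a i) = a i.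
Hypothesis a0_exp : expansion r a f a0 = a0.
Hypothesis a0_pos : forall l, (l < r)%N -> 0 < dotv a0 f`_l.

Local Notation y := (ystar r a0 a f).
Local Notation z := (zsol r a0 a f).

(** The head of [xi] is the expansion of [a0 - T], so it adds up to exactly what
    the tail leaves over. *)
Lemma solution_of_tail (xi : nat -> R) (T : 'rV[R]_k) :
  series (fun m => xi (r + m)%N *: a (r + m)%N) @ \oo --> T ->
  (forall l, (l < r)%N -> xi l = dotv (a0 - T) f`_l) -> solution a0 a xi.
Proof.
move=> xiT xiE; rewrite /solution -[X in _ --> X](subrK T).
suff -> : a0 - T = \sum_(0 <= j < r) xi j *: a j by exact: cvg_series_head.
have T_exp : expansion r a f T = T.
  by apply: expansion_series_limit xiT => m; exact: a_exp.
rewrite -a0_exp -{1}T_exp -expansionB.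
by apply: eq_big_nat => l /andP[_ lr]; rewrite xiE.
Qed.

Lemma tail_of_solution (xi : nat -> R) : solution a0 a xi ->
  exists2 T : 'rV[R]_k, series (fun m => xi (r + m)%N *: a (r + m)%N) @ \oo --> T &
    forall l, (l < r)%N -> xi l = dotv (a0 - T) f`_l.
Proof.
move=> /(@cvg_series_tail _ _ _ r) xiT; eexists; first exact: xiT.
by move=> l lr; rewrite subKr dual_coord.
Qed.

Lemma ystar_spec i :
  ((forall l, (l < r)%N -> dotv (a i) f`_l <= 0) /\ y i = 1) \/
  ((exists l, [/\ (l < r)%N, 0 < dotv (a i) f`_l &
      y i = dotv a0 f`_l / dotv (a i) f`_l]) /\
   (forall l, (l < r)%N -> 0 < dotv (a i) f`_l ->
      y i <= dotv a0 f`_l / dotv (a i) f`_l)).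
Proof.
rewrite /ystar; case: pickP => [l0 Kl0|K0]; [right; split|left; split=> //].
- elim/big_ind: _ => [|x x' hx hx'|l].
  + by exists l0; split=> //; move: Kl0; rewrite inE.
  + by rewrite minEle; case: ifP.
  + by rewrite inE => Kl; exists l.
- move=> l lr pos; have Kl : Ordinal lr \in Kset r a f i by rewrite inE.
  exact: (bigmin_le_cond _ _ Kl).
- by move=> l lr; have := K0 (Ordinal lr); rewrite inE leNgt => ->.
Qed.

Lemma ystar_gt0 i : 0 < y i.
Proof.
have [[_ ->]|[[l [lr pos ->]] _]] := ystar_spec i; first exact: ltr01.
by rewrite divr_gt0 ?a0_pos.
Qed.

Lemma zsol_basic_ge0 i l : (l < r)%N ->
  0 <= dotv a0 f`_l - dotv (a i) f`_l * y i.
Proof.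
move=> lr; rewrite subr_ge0; have [le0|pos] := leP (dotv (a i) f`_l) 0.
  by rewrite (@le_trans _ _ 0) ?(ltW (a0_pos lr)) // mulr_le0_ge0 // ltW
      ?ystar_gt0.
have [[/(_ l lr)]|[_ /(_ l lr pos)]] := ystar_spec i; first by rewrite leNgt pos.
by rewrite ler_pdivlMr // mulrC.
Qed.

Lemma zsol_nonneg m : nonneg_solution a0 a (z m).
Proof.
split; last first.
  case: m => [|m] j /=; case: ifP => jr //; first exact/ltW/a0_pos.
    exact: zsol_basic_ge0.
  by case: ifP => // _; exact/ltW/ystar_gt0.
case: m => [|m].
  apply: (@solution_of_tail _ 0) => [|l lr]; last by rewrite subr0 /= lr.
  have -> : (fun m => z 0 (r + m)%N *: a (r + m)%N) = (fun _ => 0).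
    by apply/funext => m; rewrite /= ltnNge leq_addr scale0r.
  have := @cvg_series_finite_support R 'rV[R]_k (fun=> 0) 0%N.
  by rewrite big_geq //; apply.
apply: (@solution_of_tail _ (y (r + m) *: a (r + m)%N)) => [|l lr]; last first.
  by rewrite /= lr dotvBl dotvZl mulrC.
have tailE n : z m.+1 (r + n)%N *: a (r + n)%N =
    if n == m then y (r + m) *: a (r + m)%N else 0.
  rewrite /= ltnNge leq_addr /= eqn_add2l.
  by case: eqP => [->|]; rewrite ?scale0r.
have -> : y (r + m) *: a (r + m)%N =
    \sum_(0 <= n < m.+1) z m.+1 (r + n)%N *: a (r + n)%N.
  rewrite big_nat_recr //= big_nat big1 ?add0r => [|n /andP[_ nm]].
    by have := tailE m; rewrite eqxx => <-.
  by rewrite -/(z m.+1 _) tailE ltn_eqF.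
apply: cvg_series_finite_support => n mn.
by rewrite tailE gtn_eqF.
Qed.

(** Place [r + m] is occupied by [z m.+1] only, which kills every coefficient but
    that of [z 0]; the positive first coordinate of [z 0] kills the last one. *)
Lemma zsol_lin_indep : (0 < r)%N -> lin_indep z.
Proof.
move=> r0 N c c0.
have cS m : (m.+1 < N)%N -> c m.+1 = 0.
  move=> mN; have := c0 (r + m)%N; rewrite (bigD1 (Ordinal mN)) //= big1.
    rewrite ltnNge leq_addr /= eqxx addr0 => /eqP.
    by rewrite mulf_eq0 (gt_eqF (ystar_gt0 _)) orbF => /eqP.
  move=> [[|n] nN] /=; rewrite ltnNge leq_addr /= ?mulr0 //.
  rewrite -val_eqE /= eqSS eqn_add2l eq_sym => /negbTE->; exact: mulr0.
case=> [N0|m]; last exact: cS.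
have := c0 0%N; rewrite (bigD1 (Ordinal N0)) //= r0 big1 => [/eqP|].
  by rewrite addr0 mulf_eq0 (gt_eqF (a0_pos r0)) orbF => /eqP.
by move=> [[|n] nN] // _; rewrite cS // mul0r.
Qed.

(** At a place [j >= r] a single term of the series is nonzero.  At a place
    [j < r] the partial sums split into multiples of [<a0, f_j>], of total weight
    1, and the [j]-th coordinates of the partial sums of the tail. *)
Lemma cvg_combination (gamma : nat -> R) (T : 'rV[R]_k) j :
  series gamma @ \oo --> (1 : R) ->
  series (tail_term r a0 a f gamma) @ \oo --> T ->
  series (fun m => gamma m * z m j) @ \oo -->
    (if (j < r)%N then dotv (a0 - T) f`_j else gamma (j - r).+1 * y j).
Proof.
move=> g1 gT; case: ltnP => [jr|rj]; last first.
  have jE : j = (r + (j - r))%N by rewrite subnKC.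
  move: (j - r)%N jE => n -> {j rj}.
  have nrr : (r + n < r)%N = false by rewrite ltnNge leq_addr.
  have -> : gamma n.+1 * y (r + n) =
      \sum_(0 <= m < n.+2) gamma m * z m (r + n)%N.
    rewrite big_nat_recr //= nrr eqxx big_nat big1 ?add0r // => -[|m] /=.
      by rewrite nrr mulr0.
    by rewrite nrr eqn_add2l ltnS => mn; rewrite gtn_eqF // mulr0.
  apply: cvg_series_finite_support => -[|m] //= nm.
  by rewrite nrr eqn_add2l ltn_eqF // mulr0.
(* [gamma 0] weighs [z 0], which has no tail, so it is split off. *)
have -> : dotv (a0 - T) f`_j =
    \sum_(0 <= m < 1) gamma m * z m j +
    ((1 - \sum_(0 <= m < 1) gamma m) * dotv a0 f`_j - dotv T f`_j).
  by rewrite !big_nat1 /= jr dotvBl mulrBl mul1r addrA subrKC.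
apply: cvg_series_head.
have -> : series (fun m => gamma (1 + m)%N * z (1 + m)%N j) = (fun n =>
    series (fun m => gamma (1 + m)%N) n * dotv a0 f`_j -
    series (fun m => dotv (tail_term r a0 a f gamma m) f`_j) n).
  apply/funext => n; rewrite /series /= big_distrl -sumrB.
  apply: eq_bigr => m _; rewrite /= jr dotvZl mulrBr.
  by rewrite -mulrA [y _ * _]mulrC.
apply: cvgB; last exact: cvg_series_dotv.
by apply: cvgMr_tmp; exact: cvg_series_tail.
Qed.

Lemma admissible_solution (gamma : nat -> R) :
  admissible r a0 a f gamma ->
  (forall j, cvgn (series (fun m => gamma m * z m j))) /\
  strictly_positive_solutions a0 a (combination r a0 a f gamma).
Proof.
move=> [g1 gpos gT Tpos]; set T := limn _ in Tpos.
have cvgz j := @cvg_combination _ _ j g1 gT.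
have combE j : combination r a0 a f gamma j = _ := limnE (cvgz j).
split=> [j|]; first by apply: cvgP; exact: cvgz.
split=> [|j].
  apply: (@solution_of_tail _ T) => [|l lr]; last by rewrite combE lr.
  rewrite (_ : (fun m => _) = tail_term r a0 a f gamma) //.
  by apply/funext => m; rewrite combE ltnNge leq_addr /= addKn.
rewrite combE; case: ifP => jr; first exact: Tpos.
by rewrite mulr_gt0 // ystar_gt0.
Qed.

Hypothesis a_ge0 : forall j, nonneg_vec (a j).

(** [a i] would be a nonpositive combination of nonnegative vectors, while being
    nonnegative itself. *)
Lemma no_positive_coord_eq0 i :
  (forall l, (l < r)%N -> dotv (a i) f`_l <= 0) -> a i = 0.
Proof.
move=> le0; apply/rowP => c; rewrite mxE; apply/eqP; rewrite eq_le a_ge0 andbT.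
rewrite -a_exp summxE big_nat sumr_le0 // => l /andP[_ lr].
by rewrite mxE mulr_le0_ge0 ?le0 ?a_ge0.
Qed.

(** The vector of the linear functional obtained from the sum over [l] of
    [<v, f_l> / <a0, f_l>] by taking absolute values of the entries of the [f_l].
    On nonnegative [v] it is nonnegative and bounds each of these ratios; being
    linear, it can be summed along a solution. *)
Definition gauge : 'rV[R]_k :=
  \row_c \sum_(l < r) `|f`_l 0 c| / dotv a0 f`_l.

Lemma dotv_gauge v :
  dotv v gauge = \sum_(l < r) (\sum_c v 0 c * `|f`_l 0 c|) / dotv a0 f`_l.
Proof.
under [RHS]eq_bigr do rewrite mulr_suml.
rewrite [RHS]exchange_big /=; apply: eq_bigr => c _; rewrite mxE mulr_sumr.
by apply: eq_bigr => l _; rewrite mulrA.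
Qed.

Lemma gauge_ge0 v : nonneg_vec v -> 0 <= dotv v gauge.
Proof.
move=> v0; rewrite dotv_gauge; apply: sumr_ge0 => l _.
rewrite divr_ge0 ?(ltW (a0_pos _)) //.
by apply: sumr_ge0 => c _; rewrite mulr_ge0.
Qed.

Lemma inv_ystar_le i : a i != 0 -> (y i)^-1 <= dotv (a i) gauge.
Proof.
move=> ai0; have [[/no_positive_coord_eq0 ai _]|] := ystar_spec i.
  by rewrite ai eqxx in ai0.
move=> [[l [lr pos ->]] _].
(* The ratio at which the minimum is attained is one summand of the gauge. *)
rewrite invf_div dotv_gauge (bigD1 (Ordinal lr)) //= -[leLHS]addr0 lerD //.
  rewrite ler_pM2r ?invr_gt0 ?a0_pos //; apply: ler_sum => c _.
  by rewrite ler_wpM2l ?a_ge0 // ler_norm.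
apply: sumr_ge0 => l' _; rewrite divr_ge0 ?(ltW (a0_pos _)) //.
by apply: sumr_ge0 => c _; rewrite mulr_ge0 ?a_ge0.
Qed.

(** From index [N] on, the terms are at most [xi_i <a_i, w>] with [w] the gauge,
    and these add up because [xi] is a solution.  The terms with [a_i = 0], where
    [y_i* = 1], are not controlled by the equation; this is why all but finitely
    many of the [a_i] are required to be nonzero. *)
Lemma cvg_weights (xi : nat -> R) N :
  (forall j, (N <= j)%N -> a j != 0) ->
  strictly_positive_solutions a0 a xi ->
  cvgn (series (fun m => xi (r + m)%N / y (r + m))).
Proof.
move=> aN0 [xi_sol xi_pos].
have term_ge0 j : 0 <= xi j / y j.
  by rewrite divr_ge0 ?(ltW (xi_pos _)) ?(ltW (ystar_gt0 _)).
have xi_cvg : series (fun j => dotv (xi j *: a j) gauge) @ \oo --> dotv a0 gauge.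
  exact: cvg_series_dotv.
suff xiN : cvgn (series (fun m => xi (r + (N + m))%N / y (r + (N + m)))).
  apply: cvgP; apply: (@cvg_series_head _ _ (fun m => xi (r + m)%N / y (r + m)) N).
  exact: xiN.
apply: (@series_le_cvg _ _
  (fun m => dotv (xi (r + N + m)%N *: a (r + N + m)%N) gauge)) => [m|m|m|].
- exact: term_ge0.
- by rewrite dotvZl mulr_ge0 ?gauge_ge0 // ltW.
- rewrite dotvZl addnA ler_wpM2l ?(ltW (xi_pos _)) // inv_ystar_le // aN0 //.
  by rewrite addnAC leq_addl.
apply: cvgP; apply: (@cvg_series_tail _ _
  (fun j => dotv (xi j *: a j) gauge) (r + N)); exact: xi_cvg.
Qed.

Lemma solution_admissible (xi : nat -> R) N :
  (forall j, (N <= j)%N -> a j != 0) ->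
  strictly_positive_solutions a0 a xi ->
  exists2 gamma, admissible r a0 a f gamma & combination r a0 a f gamma = xi.
Proof.
move=> aN0 xi_pos; have S_cvg := cvg_weights aN0 xi_pos.
have [xi_sol xi_gt0] := xi_pos.
have [T xiT xiE] := tail_of_solution xi_sol.
set w := fun m => xi (r + m)%N / y (r + m) in S_cvg.
(* [gamma 0] may be negative: it only brings the total mass to 1. *)
pose gamma n := if n is m.+1 then w m else 1 - limn (series w).
have g1 : series gamma @ \oo --> (1 : R).
  rewrite -[X in _ --> X](subrK (limn (series w))).
  have := @cvg_series_head _ _ gamma 1 _ S_cvg.
  by rewrite big_nat1.
have wy m : w m * y (r + m) = xi (r + m)%N by rewrite divfK // gt_eqF ?ystar_gt0.
have tailE : tail_term r a0 a f gamma = (fun m => xi (r + m)%N *: a (r + m)%N).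
  by apply/funext => m; rewrite /tail_term /= wy.
have gT : series (tail_term r a0 a f gamma) @ \oo --> T by rewrite tailE.
exists gamma.
  split=> [//|m|//|l lr].
  - by rewrite divr_gt0 ?ystar_gt0.
  - exact: cvgP gT.
  - by rewrite (limnE gT) -xiE.
apply/funext => j; rewrite /combination (limnE (@cvg_combination _ _ j g1 gT)).
case: ltnP => [jr|rj]; first by rewrite xiE.
by rewrite /= -{2}(subnKC rj) wy subnKC.
Qed.

End Solutions.

Theorem theorem12 (R : realType) (k r : nat)
    (a0 : 'rV[R]_k) (a : nat -> 'rV[R]_k) (f : k.-tuple 'rV[R]_k)
    (r_ge1 : (1 <= r)%N) (r_lek : (r <= k)%N)
    (a0_ge0 : nonneg_vec a0) (a_ge0 : forall j, nonneg_vec (a j))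
    (a0_int : cone_interior a xpredT a0)
    (dim_cone : has_dim (cone a xpredT) r)
    (a_free : free [seq a j | j <- iota 0 r])
    (a0_int_r : cone_interior a (fun j => (j < r)%N) a0)
    (f_free : free f)
    (f_dual : forall i j, (i < r)%N -> (j < r)%N -> dotv f`_i (a j) = (i == j)%:R)
    (f_orth : forall i j, (r <= i < k)%N -> (j < r)%N -> dotv f`_i (a j) = 0) :
  [/\ lin_indep (zsol r a0 a f),
      forall m, nonneg_solution a0 a (zsol r a0 a f m),
      forall gamma, admissible r a0 a f gamma ->
        (forall j, cvgn (series (fun m => gamma m * zsol r a0 a f m j))) /\
        strictly_positive_solutions a0 a (combination r a0 a f gamma) &
      (exists N, forall j, (N <= j)%N -> a j != 0) ->
        strictly_positive_solutions a0 a =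
        [set combination r a0 a f gamma | gamma in admissible r a0 a f]].
Proof.
have dual l j : (l < r)%N -> (j < r)%N -> dotv (a j) f`_l = (l == j)%:R.
  by move=> lr jr; rewrite dotvC f_dual.
have a_exp := cone_expansion dual dim_cone a_free.
have [a0_exp a0_pos] := interior_coord_gt0 dual a0_int_r.
split=> [|m|gamma|[N aN0]].
- exact: zsol_lin_indep.
- exact: zsol_nonneg.
- exact: admissible_solution.
- apply/seteqP; split=> [xi xi_pos|_ [gamma gamma_adm <-]].
    exact: solution_admissible aN0 xi_pos.
  by have [] := admissible_solution a_exp a0_exp a0_pos gamma_adm.
Qed.
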